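(* Let $m\in\mathbb N^*$ and $1\le p,q,r\le\infty$ with $\frac1p=\frac1q+\frac1r$. Let $E,F,G,H$ be Banach lattices. Let $P\in\mathcal P^{+}_{w,(q,r)}(^mE;F)$, and let $u:G\to E$ and $v:F\to H$ be positive bounded linear operators. Then $v\circ P\circ u\in\mathcal P^{+}_{w,(q,r)}(^mG;H)$ and $$d^{m+}_{w,(q,r)}(v\circ P\circ u)\le\|v\|\,d^{m+}_{w,(q,r)}(P)\,\|u\|^m.$$
   Context: All Banach lattices are real. $E^+$ is the positive cone of $E$. $\mathcal P(^mE;F)$ is the space of continuous $m$-homogeneous polynomials from $E$ to $F$. A polynomial is positive if its associated symmetric $m$-linear operator is positive (maps tuples of positive elements to positive elements), and regular if it is a difference of two positive ones. $\mathcal P^r(^mE)$ is the Banach lattice of regular scalar-valued $m$-homogeneous polynomials, with norm $\|\,|\phi|\,\|$ (supremum norm of the modulus), and $B^+_{\mathcal P^r(^mE)}$ is the set of its positive elements of norm at most $1$. For a finite sequence $(y_i)_{i=1}^n$ in a Banach lattice $G$, $\|(y_i)_{i=1}^n\|_{r,|w|}=\sup\{(\sum_{i=1}^n\langle \xi,|y_i|\rangle^r)^{1/r}:\xi\in B_{G^*},\ \xi\ge0\}$. $\|\cdot\|_p$ is the $\ell_p^n$ norm. Power sums with exponent $\infty$ are replaced by maxima. Definition. $P\in\mathcal P(^mE;F)$ is positive weakly $(q,r)$-dominated if there is $C>0$ such that for all $n$, all $(x_i)_{i=1}^n\subset E^+$ and all $(y_i^* )_{i=1}^n\subset F^{*+}$,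 $$\big\|(\langle P(x_i),y_i^*\rangle)_{i=1}^n\big\|_p\le C\sup_{\phi\in B^+_{\mathcal P^r(^mE)}}\Big(\sum_{i=1}^n\phi(x_i)^q\Big)^{1/q}\|(y_i^* )_{i=1}^n\|_{r,|w|}.$$ The space of all such $P$ is $\mathcal P^{+}_{w,(q,r)}(^mE;F)$, and $d^{m+}_{w,(q,r)}(P)$ is the infimum of all such constants $C$. *)

(* Defs.v *)
From HB Require Import structures.
From mathcomp Require Import all_boot all_order all_algebra.
From mathcomp Require Import mathcomp_extra boolp classical_sets functions.
From mathcomp Require Import perm lra.
From mathcomp Require Import reals ereal topology normedtype exp.

Set Implicit Arguments.
Unset Strict Implicit.
Unset Printing Implicit Defensive.

Import Order.TTheory GRing.Theory Num.Theory.
Import numFieldNormedType.Exports.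
Local Open Scope classical_set_scope.
Local Open Scope ring_scope.
(* The order and the supremum are fields of their own: HB rejects a join of   *)
(* [Order.Lattice] with an additive structure declared after                  *)
(* [Num.RealDomain]. Infima are [- (- x ⊔ - y)]; the last axiom says that the *)
(* norm is a lattice norm.                                                    *)
HB.mixin Record isBanachLattice (R : realType) E
    of CompleteNormedModule R E := {
  lle : E -> E -> Prop;
  ljoin : E -> E -> E;
  lle_refl : forall x, lle x x;
  lle_anti : forall x y, lle x y -> lle y x -> x = y;
  lle_trans : forall y x z, lle x y -> lle y z -> lle x z;
  lle_joinl : forall x y, lle x (ljoin x y);
  lle_joinr : forall x y, lle y (ljoin x y);
  lle_join_lub : forall x y z, lle x z -> lle y z -> lle (ljoin x y) z;
  lleD2r : forall z x y, lle x y -> lle (x + z) (y + z);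
  lleZ : forall (a : R) x y, 0 <= a -> lle x y -> lle (a *: x) (a *: y);
  lnorm_mono : forall x y : E,
    lle (ljoin x (- x)) (ljoin y (- y)) -> `|x| <= `|y|
}.

#[short(type="banachLatticeType")]
HB.structure Definition BanachLattice (R : realType) :=
  {E of CompleteNormedModule R E & isBanachLattice R E}.

Notation "x ⊑ y" := (lle x y) (at level 70, no associativity) : ring_scope.
Notation "x ⊔ y" := (ljoin x y) (at level 52, left associativity) : ring_scope.

Arguments lle_anti {R s} [x y].
Arguments lle_trans {R s} y [x z].
Arguments lle_join_lub {R s} [x y z].
Arguments lleD2r {R s} z [x y].
Arguments lleZ {R s} [a x y].
Arguments lnorm_mono {R s} [x y].

Section real_banach_lattice.
Variable R : realType.
Implicit Types x y z a : R.
Let lex_refl x : x <= x. Proof. by []. Qed.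
Let lex_anti x y : x <= y -> y <= x -> x = y.
Proof. by move=> xy yx; apply/eqP; rewrite eq_le xy. Qed.
Let lex_trans y x z : x <= y -> y <= z -> x <= z. Proof. exact: le_trans. Qed.
Let lex_maxl x y : x <= Num.max x y. Proof. by rewrite le_max lexx. Qed.
Let lex_maxr x y : y <= Num.max x y. Proof. by rewrite le_max lexx orbT. Qed.
Let lex_max_lub x y z : x <= z -> y <= z -> Num.max x y <= z.
Proof. by rewrite ge_max => -> ->. Qed.
Let lexD2r z x y : x <= y -> x + z <= y + z. Proof. by rewrite lerD2r. Qed.
Let lexZ a x y : 0 <= a -> x <= y -> a *: x <= a *: y.
Proof. by move=> a0 xy; exact: (ler_wpM2l a0 xy). Qed.
Let maxN x : Num.max x (- x) = `|x|.
Proof.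
by case: (leP 0 x) => x0; [rewrite max_l ?ger0_norm|rewrite max_r ?ltr0_norm]; lra.
Qed.
Let lex_norm x y : Num.max x (- x) <= Num.max y (- y) -> `|x| <= `|y|.
Proof. by rewrite !maxN. Qed.

HB.instance Definition _ := isBanachLattice.Build R R lex_refl lex_anti
  lex_trans lex_maxl lex_maxr lex_max_lub lexD2r lexZ lex_norm.
End real_banach_lattice.

Section sup_norm.
Variables (R : realType) (E F : normedModType R).

(* the operator norm when [f] is linear *)
Definition unif_norm (f : E -> F) : R :=
  sup [set `|f x| | x in [set x | `|x| <= 1]].

Lemma linear_bounded_ex (f : E -> F) : linear f -> continuous f ->
  exists M, forall x, `|f x| <= M * `|x|.
Proof.
move=> lf cf; pose g : {linear E -> F} :=
  HB.pack f (GRing.isLinear.Build R E F *:%R f lf).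
have /linear_boundedP/pinfty_ex_gt0[M M0 fM] : bounded_near g (nbhs 0).
  exact/linear_bounded_continuous.
by exists M.
Qed.

Lemma linear_bounded_cont (f : E -> F) M : linear f ->
  (forall x, `|f x| <= M * `|x|) -> continuous f.
Proof.
move=> lf fM; pose g : {linear E -> F} :=
  HB.pack f (GRing.isLinear.Build R E F *:%R f lf).
apply: (@bounded_linear_continuous _ _ _ g); apply/linear_boundedP.
near=> r => x; apply: (le_trans (fM x)); rewrite ler_wpM2r//.
Unshelve. all: by end_near. Qed.

Lemma unif_norm_ubound (f : E -> F) M x : (forall y, `|f y| <= M * `|y|) ->
  `|x| <= 1 -> `|f x| <= unif_norm f.
Proof.
move=> fM x1; apply: ub_le_sup; last by exists x.
exists `|M| => _ [y /= y1 <-]; apply: (le_trans (fM y)).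
apply: (le_trans (ler_norm _)); rewrite normrM normr_id.
by rewrite ler_piMr.
Qed.

Lemma unif_norm_le (f : E -> F) M : (forall x, `|x| <= 1 -> `|f x| <= M) ->
  unif_norm f <= M.
Proof.
move=> fM; apply: ge_sup => [|_ [x x1 <-]]; last exact: fM.
by exists `|f 0|, 0 => //=; rewrite normr0.
Qed.

End sup_norm.

Section dual.
Variables (R : realType) (E : normedModType R).

Definition dual_pred : {pred E -> R} :=
  fun f => `[< linear f /\ continuous f >].
Record dual := Dual { dual_fun :> E -> R; _ : dual_fun \in dual_pred }.
HB.instance Definition _ := [isSub for dual_fun].
HB.instance Definition _ := [Choice of dual by <:].

Let dual_submod_closed : submod_closed dual_pred.
Proof.
split.
  apply/asboolP; split; last by move=> x; exact: cvg_cst.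
  by move=> a x y; rewrite /= scaler0 addr0.
move=> a f g /asboolP [lf cf] /asboolP [lg cg]; apply/asboolP; split.
  move=> b x y; rewrite !fctE lf lg.
  by rewrite !scalerDr !scalerA (mulrC b) addrACA.
by move=> x; apply: cvgD; [apply: cvgZl_tmp; exact: cf|exact: cg].
Qed.
HB.instance Definition _ :=
  GRing.isSubmodClosed.Build R (E -> R) dual_pred dual_submod_closed.
HB.instance Definition _ := [SubChoice_isSubLmodule of dual by <:].

Implicit Types f g : dual.

Lemma dual_linear f : linear f.
Proof. by case: f => f /= /asboolP[]. Qed.
Lemma dual_continuous f : continuous f.
Proof. by case: f => f /= /asboolP[]. Qed.
HB.instance Definition _ f :=
  GRing.isLinear.Build R E R *:%R (dual_fun f) (@dual_linear f).

Lemma dualP f g : (forall x, f x = g x) -> f = g.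
Proof. by move=> fg; apply/val_inj/funext. Qed.
Lemma dualDE f g x : (f + g) x = f x + g x. Proof. by []. Qed.
Lemma dualNE f x : (- f) x = - f x. Proof. by []. Qed.
Lemma dualZE a f x : (a *: f) x = a * f x. Proof. by []. Qed.

Definition dual_norm f : R := unif_norm f.

Lemma dual_norm_ub f x : `|f x| <= dual_norm f * `|x|.
Proof.
have [M fM] := linear_bounded_ex (@dual_linear f) (@dual_continuous f).
have [->|x0] := eqVneq x 0; first by rewrite linear0 !normr0 mulr0.
have nx : 0 < `|x| by rewrite normr_gt0.
rewrite -ler_pdivrMr//.
have -> : `|f x| / `|x| = `|f (`|x|^-1 *: x)|.
  by rewrite linearZ normrM mulrC normfV normr_id.
by apply: (unif_norm_ubound fM); rewrite normrZ normfV normr_id mulVf ?gt_eqF.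
Qed.

Lemma dual_norm_le f M : 0 <= M -> (forall x, `|f x| <= M * `|x|) ->
  dual_norm f <= M.
Proof.
move=> M0 fM; apply: unif_norm_le => x x1; apply: (le_trans (fM x)).
by rewrite ler_piMr.
Qed.

Lemma dual_norm_ge0 f : 0 <= dual_norm f.
Proof.
have [M fM] := linear_bounded_ex (@dual_linear f) (@dual_continuous f).
by apply: (le_trans (normr_ge0 (f 0))); apply: (unif_norm_ubound fM); rewrite normr0.
Qed.

Let dual_normD f g : dual_norm (f + g) <= dual_norm f + dual_norm g.
Proof.
apply: dual_norm_le => [|x]; first by rewrite addr_ge0 ?dual_norm_ge0.
by rewrite mulrDl (le_trans (ler_normD _ _))// lerD ?dual_norm_ub.
Qed.

Let dual_normZ a f : dual_norm (a *: f) = `|a| * dual_norm f.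
Proof.
have le b h : dual_norm (b *: h) <= `|b| * dual_norm h.
  apply: dual_norm_le => [|x]; first by rewrite mulr_ge0 ?dual_norm_ge0.
  by rewrite dualZE normrM -mulrA ler_wpM2l ?dual_norm_ub.
apply/eqP; rewrite eq_le le/=.
have [->|a0] := eqVneq a 0; first by rewrite normr0 mul0r dual_norm_ge0.
rewrite -ler_pdivlMl ?normr_gt0// -normfV.
by have := le a^-1 (a *: f); rewrite scalerA mulVf// scale1r.
Qed.

Let dual_norm_eq0 f : dual_norm f = 0 -> f = 0.
Proof.
move=> f0; apply: dualP => x; apply/eqP; rewrite -normr_le0.
by have := dual_norm_ub f x; rewrite f0 mul0r.
Qed.

HB.instance Definition _ :=
  Lmodule_isNormed.Build R dual dual_normD dual_normZ dual_norm_eq0.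

Lemma dual_normE f : `|f| = unif_norm f. Proof. by []. Qed.

Let dual_complete (F : set_system dual) :
  ProperFilter F -> cauchy F -> cvg F.
Proof.
move=> FF cF.
have cFx x : cauchy ((fun f : dual => f x) @ F).
  apply/cauchy_ballP => e e0.
  have /cauchy_ballP/(_ (e / (`|x| + 1))) := cF.
  have x1 : 0 < `|x| + 1 by rewrite ltr_wpDl.
  rewrite divr_gt0// => /(_ isT).
  rewrite /= !near_simpl near_map2; apply: filterS => -[f g].
  rewrite -!ball_normE /= => fg.
  have -> : f x - g x = (f - g) x by [].
  apply: (le_lt_trans (dual_norm_ub _ _)).
  have [->|x0] := eqVneq x 0; first by rewrite normr0 mulr0.
  rewrite ltr_pdivlMr// in fg.
  apply: le_lt_trans fg; rewrite ler_wpM2l// ?dual_norm_ge0//; lra.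
pose h x := lim ((fun f : dual => f x) @ F).
have cvh x : (fun f : dual => f x) @ F --> h x by exact: cauchy_cvg.
have lh : linear h.
  move=> a x y; apply: cvg_lim => //.
  have -> : (fun f : dual => f (a *: x + y)) =
            (fun f : dual => a *: f x) \+ (fun f : dual => f y).
    by apply/funext => f; rewrite /= linearP.
  by apply: cvgD; [apply: cvgZl_tmp; exact: cvh|exact: cvh].
have unif (e : R) : 0 < e ->
    \forall f \near F, forall x,  `|h x - dual_fun f x| <= e * `|x|.
  move=> e0; have /cauchy_ballP/(_ e e0) := cF.
  rewrite near_simpl near_map2 => /nearP_dep.
  apply: filterS => /= f Hf x.
  have fF : \forall g \near F, `|dual_fun g x - f x| <= e * `|x|.
    apply: filterS Hf => g; rewrite -ball_normE /= => fg.
    rewrite distrC; have -> : f x - g x = (f - g) x by [].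
    by rewrite (le_trans (dual_norm_ub _ _))// ler_wpM2r// ltW.
  have cg : (fun g : dual => `|g x - f x|) @ F --> `|h x - f x|.
    by apply: cvg_norm; apply: cvgB; [exact: cvh|exact: cvg_cst].
  exact: (cvgr_to_le cg fF).
have [f0 hf0] : exists f : dual, forall x, `|h x - f x| <= 1 * `|x|.
  by have /filter_ex[f ?] := unif 1 ltr01; exists f.
have ch : continuous h.
  apply: (@linear_bounded_cont _ _ _ _ (1 + dual_norm f0)) => // x.
  rewrite -[h x](subrK (f0 x)) (le_trans (ler_normD _ _))// mulrDl.
  by rewrite lerD ?dual_norm_ub.
have hP : h \in dual_pred by apply/asboolP.
apply/cvg_ex; exists (Dual hP); apply/cvgrPdist_le => e e0.
near=> f; apply: dual_norm_le; first exact: ltW.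
by near: f; exact: unif.
Unshelve. all: by end_near. Qed.

HB.instance Definition _ := Uniform_isComplete.Build dual dual_complete.

End dual.

Section banach_lattice_theory.
Variables (R : realType) (E : banachLatticeType R).
Implicit Types x y z w : E.

Definition modulus x : E := x ⊔ - x.

Lemma lleD x y z w : x ⊑ y -> z ⊑ w -> x + z ⊑ y + w.
Proof.
move=> xy zw; apply: (lle_trans (y + z)); first exact: lleD2r.
by rewrite addrC [y + w]addrC; exact: lleD2r.
Qed.

Lemma lle_subr x y : x ⊑ y -> 0 ⊑ y - x.
Proof. by move=> /(lleD2r (- x)); rewrite subrr. Qed.

Lemma lle_addr x y : 0 ⊑ y - x -> x ⊑ y.
Proof. by move=> /(lleD2r x); rewrite add0r subrK. Qed.

Lemma lleN x y : x ⊑ y -> - y ⊑ - x.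
Proof. by move=> xy; apply: lle_addr; rewrite opprK addrC; exact: lle_subr. Qed.

Lemma lleD0 x y : 0 ⊑ x -> 0 ⊑ y -> 0 ⊑ x + y.
Proof. by move=> x0 y0; rewrite -[0]addr0; exact: lleD. Qed.

Lemma lleZ0 (a : R) x : 0 <= a -> 0 ⊑ x -> 0 ⊑ a *: x.
Proof. by move=> a0 x0; rewrite -(scaler0 _ a); exact: lleZ. Qed.

Let halfDhalf : 2^-1 + 2^-1 = 1 :> R. Proof. by lra. Qed.

Lemma lle_half x y : x + x ⊑ y + y -> x ⊑ y.
Proof.
have h z : z = 2^-1 *: (z + z) by rewrite scalerDr -scalerDl halfDhalf scale1r.
by move=> xy; rewrite (h x) (h y); apply: lleZ => //; rewrite invr_ge0.
Qed.

Lemma modulus_ge0 x : 0 ⊑ modulus x.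
Proof.
apply: lle_half; rewrite addr0 -(subrr x).
by apply: lleD; [exact: lle_joinl|exact: lle_joinr].
Qed.

Lemma modulus_id x : 0 ⊑ x -> modulus x = x.
Proof.
move=> x0; apply: lle_anti; last exact: lle_joinl.
apply: lle_join_lub; first exact: lle_refl.
by apply: (lle_trans 0) => //; rewrite -oppr0; exact: lleN.
Qed.

Lemma lnorm_le x y : x ⊑ y -> - x ⊑ y -> `|x| <= `|y|.
Proof.
move=> xy nxy; apply: lnorm_mono.
by apply: (lle_trans y); [exact: lle_join_lub|exact: lle_joinl].
Qed.

Lemma lnorm_ge0_le x y : 0 ⊑ x -> x ⊑ y -> `|x| <= `|y|.
Proof.
move=> x0 xy; apply: lnorm_le => //.
apply: (lle_trans 0); first by rewrite -oppr0; exact: lleN.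
exact: (lle_trans x).
Qed.

Lemma lnorm_modulus x : `|modulus x| = `|x|.
Proof.
apply/eqP; rewrite eq_le; apply/andP; split; apply: lnorm_mono.
  change (modulus (modulus x) ⊑ modulus x).
  by rewrite modulus_id; [exact: lle_refl|exact: modulus_ge0].
change (modulus x ⊑ modulus (modulus x)).
by rewrite [modulus (modulus _)]modulus_id; [exact: lle_refl|exact: modulus_ge0].
Qed.

Definition lpos x : E := x ⊔ 0.
Definition lneg x : E := - x ⊔ 0.

Lemma lnegE x : lneg x = lpos x - x.
Proof.
apply: lle_anti.
  apply: lle_join_lub; last by apply: lle_subr; exact: lle_joinl.
  by rewrite -[X in X ⊑ _]add0r; apply: lleD2r; exact: lle_joinr.
rewrite -[X in _ ⊑ X](addrK x); apply: lleD2r; apply: lle_join_lub.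
  by rewrite -[X in X ⊑ _]add0r; apply: lleD2r; exact: lle_joinr.
by rewrite -(addNr x); apply: lleD2r; exact: lle_joinl.
Qed.

Lemma lpos_ge0 x : 0 ⊑ lpos x. Proof. exact: lle_joinr. Qed.
Lemma lneg_ge0 x : 0 ⊑ lneg x.
Proof. exact: lle_joinr. Qed.
Lemma lposBneg x : x = lpos x - lneg x.
Proof. by rewrite lnegE subKr. Qed.

Lemma lposDneg_le x : lpos x + lneg x ⊑ modulus x.
Proof.
rewrite lnegE addrA; apply: lle_addr; rewrite opprB addrA.
apply: lle_subr; have xm : x + x ⊑ modulus x + x.
  by apply: lleD; [exact: lle_joinl|exact: lle_refl].
have m0 : 0 ⊑ modulus x + x.
  by rewrite -(subrr x) [modulus x + x]addrC; apply: lleD; [exact: lle_refl|exact: lle_joinr].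
set w := modulus x + x in xm m0 *.
have -> : w = 2^-1 *: w + 2^-1 *: w by rewrite -scalerDl halfDhalf scale1r.
have i2 : 0 <= 2^-1 :> R by rewrite invr_ge0.
have h : lpos x ⊑ 2^-1 *: w.
  apply: lle_join_lub; last exact: lleZ0.
  apply: lle_half; rewrite -scalerDl halfDhalf scale1r//.
exact: lleD.
Qed.

Lemma lnorm_posDneg x : `|lpos x + lneg x| <= `|x|.
Proof.
rewrite -[leRHS]lnorm_modulus; apply: lnorm_ge0_le; last exact: lposDneg_le.
by apply: lleD0; [exact: lpos_ge0|exact: lneg_ge0].
Qed.

Lemma lnorm_pos x : `|lpos x| <= `|x|.
Proof.
apply: le_trans (lnorm_posDneg x); apply: lnorm_ge0_le; first exact: lpos_ge0.
by rewrite -[X in X ⊑ _]addr0; apply: lleD; [exact: lle_refl|exact: lneg_ge0].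
Qed.

Lemma lnorm_neg x : `|lneg x| <= `|x|.
Proof.
apply: le_trans (lnorm_posDneg x); apply: lnorm_ge0_le; first exact: lneg_ge0.
by rewrite -[X in X ⊑ _]add0r; apply: lleD; [exact: lpos_ge0|exact: lle_refl].
Qed.

Lemma riesz_decomposition x y z : 0 ⊑ x -> 0 ⊑ y -> 0 ⊑ z -> z ⊑ x + y ->
  exists z1 z2, [/\ 0 ⊑ z1, z1 ⊑ x, 0 ⊑ z2, z2 ⊑ y & z = z1 + z2].
Proof.
move=> x0 y0 z0 zxy; exists (z - lpos (z - x)), (lpos (z - x)); split.
- apply: lle_subr; apply: lle_join_lub => //.
  by rewrite -[X in _ ⊑ X]subr0; apply: lleD; [exact: lle_refl|exact: lleN].
- apply: lle_addr; rewrite opprB addrCA -(opprB z x); apply: lle_subr.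
  exact: lle_joinl.
- exact: lpos_ge0.
- apply: lle_join_lub => //.
  by apply: lle_addr; rewrite opprB addrA; apply: lle_subr; rewrite addrC.
- by rewrite subrK.
Qed.

End banach_lattice_theory.

Section dual_lattice.
Variables (R : realType) (E : banachLatticeType R).
Implicit Types (f g h : dual E) (x y z : E).

(* On the positive cone, [fpos f] is the positive part of [f] given by the    *)
(* Riesz-Kantorovich formula.                                                 *)
Definition below f x : set R := [set f y | y in [set y | 0 ⊑ y /\ y ⊑ x]].
Definition fpos f x : R := sup (below f x).

Lemma below_le f x : ubound (below f x) (`|f| * `|x|).
Proof.
move=> _ [y /= [y0 yx] <-]; apply: (le_trans (ler_norm _)).
apply: (le_trans (dual_norm_ub _ _)).
by apply: (ler_wpM2l (normr_ge0 f)); exact: lnorm_ge0_le.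
Qed.

Lemma fpos_ub f x y : 0 ⊑ y -> y ⊑ x -> f y <= fpos f x.
Proof.
move=> y0 yx; apply: ub_le_sup; last by exists y.
by exists (`|f| * `|x|); exact: below_le.
Qed.

Lemma fpos_le f x M : 0 ⊑ x -> (forall y, 0 ⊑ y -> y ⊑ x -> f y <= M) ->
  fpos f x <= M.
Proof.
move=> x0 fM; apply: ge_sup => [|_ [y [y0 yx] <-]]; last exact: fM.
by exists (f 0), 0 => //; split => //; exact: lle_refl.
Qed.

Lemma fpos_ge0 f x : 0 ⊑ x -> 0 <= fpos f x.
Proof. by move=> x0; rewrite -(linear0 f); apply: fpos_ub => //; exact: lle_refl. Qed.

Lemma fpos0 f : fpos f 0 = 0.
Proof.
apply/eqP; rewrite eq_le fpos_ge0 ?andbT; last exact: lle_refl.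
apply: fpos_le => [|y y0 yx]; first exact: lle_refl.
by rewrite (lle_anti yx y0) linear0.
Qed.

Lemma fposD f x y : 0 ⊑ x -> 0 ⊑ y -> fpos f (x + y) = fpos f x + fpos f y.
Proof.
move=> x0 y0; apply/eqP; rewrite eq_le; apply/andP; split.
  apply: fpos_le => [|z z0 zxy]; first exact: lleD0.
  have [z1 [z2 [? ? ? ? ->]]] := riesz_decomposition x0 y0 z0 zxy.
  by rewrite linearD lerD// fpos_ub.
rewrite -lerBrDr; apply: fpos_le => // z z0 zx.
rewrite lerBrDr addrC -lerBrDr; apply: fpos_le => // w w0 wy.
by rewrite lerBrDr -linearD; apply: fpos_ub; [exact: lleD0|rewrite addrC; exact: lleD].
Qed.

Lemma fposZ f (a : R) x : 0 <= a -> 0 ⊑ x -> fpos f (a *: x) = a * fpos f x.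
Proof.
rewrite le_eqVlt => /predU1P[<-|] x0; first by rewrite scale0r mul0r fpos0.
have le b y : 0 < b -> 0 ⊑ y -> fpos f (b *: y) <= b * fpos f y.
  move=> b0 y0; apply: fpos_le => [|z z0 zy]; first exact: lleZ0 (ltW b0) y0.
  rewrite -ler_pdivrMl//; have -> : b^-1 * f z = f (b^-1 *: z) by rewrite linearZ.
  have b0' : 0 <= b^-1 by rewrite invr_ge0 ltW.
  apply: fpos_ub; first exact: lleZ0.
  by have := lleZ b0' zy; rewrite scalerA mulVf ?gt_eqF// scale1r.
move=> y0; apply/eqP; rewrite eq_le le//=.
have a0' : 0 < a^-1 by rewrite invr_gt0.
have := le a^-1 (a *: x) a0' (lleZ0 (ltW x0) y0).
by rewrite scalerA mulVf ?gt_eqF// scale1r ler_pdivlMl.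
Qed.

Definition fpos_ext f x : R := fpos f (lpos x) - fpos f (lneg x).

Lemma fpos_extB f x y : 0 ⊑ x -> 0 ⊑ y ->
  fpos_ext f (x - y) = fpos f x - fpos f y.
Proof.
move=> x0 y0; set w := x - y.
have [p0 n0] := (lpos_ge0 w, lneg_ge0 w).
have : lpos w + y = x + lneg w.
  have <- : w + lneg w = lpos w by rewrite {1}[w]lposBneg subrK.
  by rewrite /w addrAC subrK.
move/(congr1 (fpos f)); rewrite (fposD f p0 y0) (fposD f x0 n0) /fpos_ext => e.
by apply/eqP; rewrite subr_eq addrAC -e addrK.
Qed.

Lemma fpos_ext_linear f : linear (fpos_ext f).
Proof.
move=> a x y; have [p0 n0] := (lpos_ge0 x, lneg_ge0 x).
have [p0' n0'] := (lpos_ge0 y, lneg_ge0 y).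
have [a0|/ltW a0] := leP 0 a.
  have -> : a *: x + y = (a *: lpos x + lpos y) - (a *: lneg x + lneg y).
    rewrite {1}[x]lposBneg {1}[y]lposBneg.
    move: (lpos x) (lneg x) (lpos y) (lneg y) => p n p' n'.
    by rewrite scalerBr opprD addrACA.
  have [ap an] := (lleZ0 a0 p0, lleZ0 a0 n0).
  rewrite (fpos_extB f (lleD0 ap p0') (lleD0 an n0')).
  rewrite (fposD f ap p0') (fposD f an n0') (fposZ f a0 p0) (fposZ f a0 n0).
  by rewrite /fpos_ext /GRing.scale/=; lra.
have a0' : 0 <= - a by rewrite oppr_ge0.
have -> : a *: x + y = (- a *: lneg x + lpos y) - (- a *: lpos x + lneg y).
  rewrite {1}[x]lposBneg {1}[y]lposBneg.
  move: (lpos x) (lneg x) (lpos y) (lneg y) => p n p' n'.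
  by rewrite scalerBr !scaleNr opprD opprK [RHS]addrACA [- _ + _ in RHS]addrC.
have [ap an] := (lleZ0 a0' p0, lleZ0 a0' n0).
rewrite (fpos_extB f (lleD0 an p0') (lleD0 ap n0')).
rewrite (fposD f an p0') (fposD f ap n0') (fposZ f a0' p0) (fposZ f a0' n0).
by rewrite /fpos_ext /GRing.scale/=; lra.
Qed.

Lemma fpos_ext_bounded f x : `|fpos_ext f x| <= `|f| * `|x|.
Proof.
have le y : 0 ⊑ y -> fpos f y <= `|f| * `|y|.
  by move=> y0; apply: fpos_le => // z z0 zy; apply: below_le; exists z.
have [p0 n0] := (lpos_ge0 x, lneg_ge0 x).
have := fpos_ge0 f p0; have := fpos_ge0 f n0.
have := le _ p0; have := le _ n0.
have := ler_wpM2l (normr_ge0 f) (lnorm_pos x).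
have := ler_wpM2l (normr_ge0 f) (lnorm_neg x).
by rewrite ler_norml /fpos_ext; lra.
Qed.

Lemma fpos_ext_dual f : fpos_ext f \in @dual_pred R E.
Proof.
apply/asboolP; split; first exact: fpos_ext_linear.
apply: (@linear_bounded_cont _ _ _ _ `|f|); first exact: fpos_ext_linear.
exact: fpos_ext_bounded.
Qed.

Definition dual_pos f : dual E := Dual (fpos_ext_dual f).

Lemma dual_posE f x : 0 ⊑ x -> dual_pos f x = fpos f x.
Proof.
move=> x0; rewrite /= -[X in fpos_ext _ X]subr0 fpos_extB//; last exact: lle_refl.
by rewrite fpos0 subr0.
Qed.

Definition dual_le f g : Prop := forall x, 0 ⊑ x -> f x <= g x.
Definition dual_join f g : dual E := g + dual_pos (f - g).

Let dual_le_refl f : dual_le f f. Proof. by move=> x. Qed.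

Let dual_le_anti f g : dual_le f g -> dual_le g f -> f = g.
Proof.
move=> fg gf; have eqp x : 0 ⊑ x -> f x = g x.
  by move=> x0; apply/eqP; rewrite eq_le fg// gf.
apply: dualP => x; rewrite [x]lposBneg !linearB /= !eqp//.
  exact: lneg_ge0.
exact: lpos_ge0.
Qed.

Let dual_le_trans g f h : dual_le f g -> dual_le g h -> dual_le f h.
Proof. by move=> fg gh x x0; apply: le_trans (fg x x0) (gh x x0). Qed.

Let dual_le_joinl f g : dual_le f (dual_join f g).
Proof.
move=> x x0; rewrite dualDE dual_posE// -lerBlDl.
by apply: (@fpos_ub (f - g)) => //; exact: lle_refl.
Qed.

Let dual_le_joinr f g : dual_le g (dual_join f g).
Proof. by move=> x x0; rewrite dualDE dual_posE// lerDl fpos_ge0. Qed.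

Let dual_le_join_lub f g h :
  dual_le f h -> dual_le g h -> dual_le (dual_join f g) h.
Proof.
move=> fh gh x x0; rewrite dualDE dual_posE// -lerBrDl.
apply: fpos_le => // y y0 yx; rewrite dualDE dualNE.
have /gh := lle_subr yx; rewrite !linearB; have := fh _ y0; lra.
Qed.

Let dual_leD2r h f g : dual_le f g -> dual_le (f + h) (g + h).
Proof. by move=> fg x x0; rewrite !dualDE lerD2r fg. Qed.

Let dual_leZ (a : R) f g : 0 <= a -> dual_le f g -> dual_le (a *: f) (a *: g).
Proof. by move=> a0 fg x x0; rewrite !dualZE ler_wpM2l ?fg. Qed.

Let dual_norm_mono f g :
  dual_le (dual_join f (- f)) (dual_join g (- g)) -> `|f| <= `|g|.
Proof.
move=> fg; apply: dual_norm_le => // x.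
have [p0 n0] := (lpos_ge0 x, lneg_ge0 x).
set z := lpos x + lneg x.
have z0 : 0 ⊑ z by exact: lleD0.
have fz : `|f x| <= dual_join f (- f) z.
  have := dual_le_joinl f (- f) p0; have := dual_le_joinr f (- f) p0.
  have := dual_le_joinl f (- f) n0; have := dual_le_joinr f (- f) n0.
  have -> : f x = f (lpos x) - f (lneg x) by rewrite {1}[x]lposBneg linearB.
  by rewrite /z linearD !dualNE ler_norml; lra.
have gz : dual_join g (- g) z <= `|g| * `|z|.
  rewrite dualDE dualNE dual_posE// addrC lerBlDr.
  apply: fpos_le => // y y0 yz; rewrite dualDE dualNE dualNE opprK.
  have -> : g y + g y = g (y - (z - y)) + g z by rewrite !linearB /=; lra.
  rewrite lerD2r; apply: (le_trans (ler_norm _)).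
  apply: (le_trans (dual_norm_ub _ _)).
  apply: (ler_wpM2l (normr_ge0 g)).
  apply: lnorm_le; last rewrite opprB.
    apply: lle_addr; rewrite opprB addrCA.
    exact: lleD0 (lle_subr yz) (lle_subr yz).
  apply: lle_addr; rewrite !opprB addrCA [z + _]addrCA subrr addr0.
  exact: lleD0.
apply: (le_trans fz); apply: (le_trans (fg _ z0)); apply: (le_trans gz).
by rewrite ler_wpM2l// lnorm_posDneg.
Qed.

HB.instance Definition _ := isBanachLattice.Build R (dual E)
  dual_le_refl dual_le_anti dual_le_trans dual_le_joinl dual_le_joinr
  dual_le_join_lub dual_leD2r dual_leZ dual_norm_mono.

End dual_lattice.

Section polynomials.
Variables (R : realType) (m : nat).

Definition multilinear (E F : lmodType R) (A : ('I_m -> E) -> F) : Prop :=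
  forall (i : 'I_m) (x : 'I_m -> E) (a : R) (y z : E),
    A (dfwith x i (a *: y + z)) = a *: A (dfwith x i y) + A (dfwith x i z).

Definition symmetric_map (E F : Type) (A : ('I_m -> E) -> F) : Prop :=
  forall (s : 'S_m) (x : 'I_m -> E), A (x \o s) = A x.

(* [A] is the symmetric m-linear operator associated with [P]; by the         *)
(* polarization formula it is unique.                                         *)
Definition associated (E F : lmodType R) (A : ('I_m -> E) -> F)
    (P : E -> F) : Prop :=
  [/\ multilinear A, symmetric_map A & forall x, P x = A (fun=> x)].

Definition hom_poly (E F : normedModType R) : set (E -> F) :=
  [set P | (exists A, associated A P) /\ continuous P].

Definition pos_poly (E F : banachLatticeType R) : set (E -> F) :=
  [set P | hom_poly P /\
    exists2 A, associated A P & forall x, (forall i, 0 ⊑ x i) -> 0 ⊑ A x].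

Section regular.
Variable E : banachLatticeType R.
Implicit Types phi psi chi : E -> R.

Definition reg_poly : set (E -> R) :=
  [set phi | exists phi1 phi2, [/\ pos_poly phi1, pos_poly phi2
                                 & phi = phi1 - phi2]].

Definition poly_le phi psi : Prop := pos_poly (psi - phi).

(* [psi] is the modulus of [phi] in the ordered space of regular polynomials, *)
(* i.e. the least upper bound of [phi] and [- phi] there.                     *)
Definition is_poly_modulus phi psi : Prop :=
  [/\ reg_poly psi, poly_le phi psi, poly_le (- phi) psi
    & forall chi, reg_poly chi -> poly_le phi chi -> poly_le (- phi) chi ->
        poly_le psi chi].

(* The default value 0 is never reached on [reg_poly], which is a lattice.    *)
Definition poly_modulus phi : E -> R := xget 0 [set psi | is_poly_modulus phi psi].

Definition reg_norm phi : R := unif_norm (poly_modulus phi).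

Definition pos_reg_ball : set (E -> R) :=
  [set phi | [/\ reg_poly phi, pos_poly phi & reg_norm phi <= 1]].

End regular.
End polynomials.

(* The l_p^n norm for an exponent in [1, +oo]. *)
Definition lp_norm (R : realType) (p : \bar R) (n : nat) (a : 'I_n -> R) : R :=
  match p with
  | EFin s => (\sum_(i < n) `|a i| `^ s) `^ s^-1
  | EPInf => \big[Num.max/0]_(i < n) `|a i|
  | ENInf => 0
  end.

Section dominated.
Variables (R : realType) (m : nat) (p q r : \bar R).

Definition abs_weak_norm (G : banachLatticeType R) (n : nat)
    (y : 'I_n -> G) : R :=
  sup [set lp_norm r (fun i => xi (modulus (y i)))
      | xi in [set xi : dual G | `|xi| <= 1 /\ 0 ⊑ xi]].

Variables E F : banachLatticeType R.
Implicit Types (P : E -> F) (C : R).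

Definition poly_weak_norm (n : nat) (x : 'I_n -> E) : R :=
  sup [set lp_norm q (fun i => phi (x i)) | phi in @pos_reg_ball R m E].

Definition dominated_by P C : Prop :=
  forall (n : nat) (x : 'I_n -> E) (y : 'I_n -> dual F),
    (forall i, 0 ⊑ x i) -> (forall i, 0 ⊑ y i) ->
    lp_norm p (fun i => y i (P (x i)))
      <= C * poly_weak_norm x * abs_weak_norm y.

Definition pos_weak_dominated : set (E -> F) :=
  [set P | hom_poly m P /\ exists2 C, 0 < C & dominated_by P C].

Definition dominated_norm P : R :=
  inf [set C | 0 < C /\ dominated_by P C].

End dominated.

Definition pos_operator (R : realType) (E F : banachLatticeType R)
    (u : E -> F) : Prop := forall x, 0 ⊑ x -> 0 ⊑ u x.

(* Main.v *)
Require Import Defs.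
From HB Require Import structures.
From mathcomp Require Import all_boot all_order all_algebra.
From mathcomp Require Import mathcomp_extra boolp classical_sets functions.
From mathcomp Require Import ring.
From mathcomp Require Import reals ereal topology normedtype exp.

Set Implicit Arguments.
Unset Strict Implicit.
Unset Printing Implicit Defensive.

Import Order.TTheory GRing.Theory Num.Theory.
Import numFieldNormedType.Exports.

Local Open Scope classical_set_scope.
Local Open Scope ring_scope.

(* Apply the domination of [P] to [u x_i] and to the functionals [y_i o v].   *)
(* For [phi] in the positive unit ball of regular polynomials on [E],         *)
(* [phi o u] is positive on [G] of norm at most [|u|^m], so the polynomial    *)
(* weak norm grows by at most [|u|^m]; dually [xi o v*] is positive of norm   *)
(* at most [|v|] for positive [xi] in the ball of [F**]. That the regular     *)
(* norm of a positive [phi] is its sup norm requires [phi] to be its own      *)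
(* modulus, i.e. antisymmetry of the order on polynomials: a homogeneous      *)
(* polynomial that vanishes on the positive cone is zero.                     *)

(** Testing [v (P (u x_i))] against [y_i] is testing [P (u x_i)] against the adjoint of [v] at
    [y_i], so a constant [C] for [P] bounds the left side by [C] times two weak norms of transported
    families. Each transport costs an operator norm, by normalisation: [phi o u] divided by [|u|^m],
    and likewise a positive functional composed with the adjoint and divided by its norm, are again
    test objects ([poly_weak_norm_comp], [abs_weak_norm_comp]); a zero norm is treated apart. Hence
    [|v| C |u|^m] satisfies the inequality for [v o P o u], and the infimum over [C] gives the
    estimate. The ball is made tractable by [pos_reg_ball_pos], which rests on [hom_poly_eq0]: on a
    line, a multilinear form is a polynomial in one variable, and it vanishes if all naturals are
    roots. *)

Section sup_and_lp_norm.
Variable R : realType.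
Implicit Types (A : set R) (c : R) (p : \bar R).

Lemma sup_ge0 A : (forall x, A x -> 0 <= x) -> 0 <= sup A.
Proof.
(* The default value of [sup] on an empty or unbounded set is 0. *)
move=> A0; have [supA|/sup_out ->//] := pselect (has_sup A).
have [[x Ax] ubA] := supA.
by apply: le_trans (A0 _ Ax) _; apply: ub_le_sup.
Qed.

Lemma lp_norm_ge0 p n (a : 'I_n -> R) : 0 <= lp_norm p a.
Proof.
case: p => [s| |] //=; first exact: powR_ge0.
by apply: (big_ind (fun x : R => 0 <= x)) => // x y x0 y0; rewrite le_max x0.
Qed.

Lemma lp_normZ p n c (a : 'I_n -> R) : (1 <= p)%E -> 0 <= c ->
  lp_norm p (fun i => c * a i) = c * lp_norm p a.
Proof.
move=> + c0; case: p => [s| |] //=; rewrite ?lee_fin => s1.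
  have s0 : s != 0 by rewrite gt_eqF// (lt_le_trans ltr01).
  under eq_bigr => i _ do rewrite normrM (ger0_norm c0) powRM//.
  rewrite -mulr_sumr powRM ?powR_ge0//; last first.
    by apply: sumr_ge0 => i _; exact: powR_ge0.
  by rewrite -powRrM divff// powRr1.
rewrite (big_morph (fun x => c * x) (fun x y => maxr_pMr x y c0) (mulr0 c)).
by apply: eq_bigr => i _; rewrite normrM ger0_norm.
Qed.

Lemma lp_norm_le p n (a b : 'I_n -> R) : (1 <= p)%E ->
  (forall i, `|a i| <= `|b i|) -> lp_norm p a <= lp_norm p b.
Proof.
case: p => [s s1 ab|_ ab|/=]; last by rewrite leeNy_eq.
  rewrite lee_fin in s1; have s0 : 0 <= s := le_trans ler01 s1.
  have pow0 (f : 'I_n -> R) : 0 <= \sum_(i < n) `|f i| `^ s.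
    by apply: sumr_ge0 => i _; exact: powR_ge0.
  apply: ge0_ler_powR; rewrite ?invr_ge0 ?nnegrE//.
  by apply: ler_sum => i _; apply: ge0_ler_powR; rewrite ?nnegrE.
by apply: le_bigmax2 => i _; exact: ab.
Qed.

Lemma lp_norm0 p n (a : 'I_n -> R) : (1 <= p)%E -> (forall i, a i = 0) ->
  lp_norm p a = 0.
Proof.
move=> p1 a0; have -> : a = (fun i => 0 * a i).
  by apply/funext => i; rewrite mul0r a0.
by rewrite lp_normZ// mul0r.
Qed.

End sup_and_lp_norm.

(** * Sup norm of continuous homogeneous maps *)

Section homogeneous.
Variables (R : realType) (m : nat) (E F : normedModType R) (P : E -> F).
Hypothesis P_hom : forall a x, P (a *: x) = a ^+ m *: P x.
Hypothesis P_cont : continuous P.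

(** Continuity at 0 bounds [P] on a small ball, and homogeneity rescales this to the unit ball. The
    bound involves [P 0], which may be nonzero in degree 0. *)
Lemma homogeneous_bounded : exists M, forall x, `|x| <= 1 -> `|P x| <= M.
Proof.
have /cvgrPdist_lt/(_ 1 ltr01)/nbhs_ballP[d /= d0 Pd] := @P_cont 0.
pose c := d / 2; have c0 : 0 < c by rewrite divr_gt0.
exists (c^-1 ^+ m * (`|P 0| + 1)) => x x1.
have -> : x = c^-1 *: (c *: x) by rewrite scalerA mulVf ?gt_eqF// scale1r.
rewrite P_hom normrZ normrX normfV (gtr0_norm c0) ler_wpM2l ?exprn_ge0//.
  by rewrite invr_ge0 ltW.
have /Pd/= : ball 0 d (c *: x).
  rewrite -ball_normE/= sub0r normrN normrZ (gtr0_norm c0).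
  apply: (@le_lt_trans _ _ c); first by rewrite ler_piMr// ltW.
  by rewrite ltr_pdivrMr// ltr_pMr// ltr1n.
move=> /ltW P1; rewrite -[P _](subKr (P 0)).
by rewrite (le_trans (ler_normB _ _))// lerD2l.
Qed.

Lemma unif_norm_ub1 x : `|x| <= 1 -> `|P x| <= unif_norm P.
Proof.
have [M PM] := homogeneous_bounded; move=> x1.
apply: ub_le_sup; last by exists x.
by exists M => _ [y /= y1 <-]; exact: PM.
Qed.

Lemma unif_norm_homogeneous_ge0 : 0 <= unif_norm P.
Proof. by apply: le_trans (unif_norm_ub1 (x := 0) _); rewrite ?normr0. Qed.

Lemma unif_norm_ub x : `|P x| <= unif_norm P * `|x| ^+ m.
Proof.
have [->|x0] := eqVneq x 0.
  (* In degree 0 the factor [0 ^+ 0] is 1; in positive degree homogeneity forces [P 0 = 0]. *)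
  case: m P_hom => [|k] hom.
    by rewrite expr0 mulr1 unif_norm_ub1// normr0.
  by rewrite -(scale0r (0 : E)) hom expr0n/= scale0r normr0 scale0r normr0
    expr0n mulr0.
have nx : 0 < `|x| by rewrite normr_gt0.
have {1}-> : x = `|x| *: (`|x|^-1 *: x).
  by rewrite scalerA mulfV ?gt_eqF// scale1r.
rewrite P_hom normrZ normrX normr_id mulrC ler_wpM2r ?exprn_ge0//.
by apply: unif_norm_ub1; rewrite normrZ normfV normr_id mulVf ?gt_eqF.
Qed.

End homogeneous.

(** * Operator norm, as the case of degree 1 *)

Section operator_norm.
Variables (R : realType) (E F : normedModType R) (u : {linear E -> F}).
Hypothesis u_cont : continuous u.

Let u_hom a x : u (a *: x) = a ^+ 1 *: u x.
Proof. by rewrite expr1 linearZ. Qed.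

Lemma opnorm_ge0 : 0 <= unif_norm u.
Proof. exact: (unif_norm_homogeneous_ge0 u_hom). Qed.

Lemma opnorm_ub x : `|u x| <= unif_norm u * `|x|.
Proof. exact: (unif_norm_ub u_hom). Qed.

End operator_norm.

(** * Adjoint operators *)

Section adjoint.
Variables (R : realType) (E F : normedModType R) (u : {linear E -> F}).
Hypothesis u_cont : continuous u.

Lemma adjoint_subproof (y : dual F) : y \o u \in @dual_pred R E.
Proof.
apply/asboolP; split; first by move=> a x z; rewrite /= !linearP.
move=> x; apply: continuous_comp; [exact: u_cont|exact: dual_continuous].
Qed.

(** It is shown to be a continuous linear map so that [abs_weak_norm_comp] can be applied to it in
    turn, with functionals from the bidual. *)
Definition adjoint (y : dual F) : dual E := Dual (adjoint_subproof y).

Lemma adjoint_linear : linear adjoint.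
Proof. by move=> a y z; apply: dualP. Qed.

HB.instance Definition _ :=
  GRing.isLinear.Build R (dual F) (dual E) *:%R adjoint adjoint_linear.

Lemma adjoint_norm (y : dual F) : `|adjoint y| <= unif_norm u * `|y|.
Proof.
apply: dual_norm_le => [|x]; first exact: mulr_ge0 (opnorm_ge0 _) _.
apply: le_trans (dual_norm_ub y (u x)) _; rewrite mulrAC [leRHS]mulrC.
by apply: (ler_wpM2l (normr_ge0 y)); exact: opnorm_ub.
Qed.

Lemma adjoint_continuous : continuous adjoint.
Proof. exact: linear_bounded_cont adjoint_linear adjoint_norm. Qed.

Lemma unif_norm_adjoint : unif_norm adjoint <= unif_norm u.
Proof.
apply: unif_norm_le => y y1; apply: le_trans (adjoint_norm _) _.
by rewrite ler_piMr// opnorm_ge0.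
Qed.

End adjoint.

(** * Multilinear maps and homogeneous polynomials *)

Section polynomials.
Variables (R : realType) (m : nat).

Lemma comp_dfwith (E F : Type) (u : E -> F) (x : 'I_m -> E) i y :
  u \o dfwith x i y = dfwith (u \o x) i (u y).
Proof.
apply/funext => j /=; have [->|ij] := eqVneq i j; first by rewrite !dfwithin.
by rewrite !dfwithout.
Qed.

Lemma associated_comp (E F G H : lmodType R) (A : ('I_m -> E) -> F) P
    (u : {linear G -> E}) (v : {linear F -> H}) :
  associated A P -> associated (fun x => v (A (u \o x))) (v \o P \o u).
Proof.
move=> [Alin Asym AP]; split.
- by move=> i x a y z; rewrite !comp_dfwith linearP Alin linearP.
- by move=> s x; rewrite compA Asym.
- by move=> x /=; rewrite AP.
Qed.

Lemma associated_comb (E F : lmodType R) a (A B : ('I_m -> E) -> F) P Q :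
  associated A P -> associated B Q ->
  associated (fun x => a *: A x + B x) (fun x => a *: P x + Q x).
Proof.
move=> [Alin Asym AP] [Blin Bsym BQ]; split.
- move=> i x b y z; rewrite Alin Blin !scalerDr !scalerA (mulrC b).
  by rewrite -!addrA; congr (_ + _); rewrite addrCA.
- by move=> s x; rewrite Asym Bsym.
- by move=> x; rewrite AP BQ.
Qed.

Lemma associated0 (E F : lmodType R) :
  associated (fun _ : 'I_m -> E => 0 : F) (fun=> 0).
Proof. by split=> // i x a y z; rewrite scaler0 addr0. Qed.

Lemma multilinear_dfwithZ (E F : lmodType R) (A : ('I_m -> E) -> F)
    (i : 'I_m) (x : 'I_m -> E) (a : R) (y : E) :
  multilinear A -> A (dfwith x i (a *: y)) = a *: A (dfwith x i y).
Proof.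
(* With scalar -1 and both vectors 0, linearity says that this value is its own negative plus
   itself. *)
move=> Alin; have A0 : A (dfwith x i 0) = 0.
  by have := Alin i x (-1) 0 0; rewrite scaler0 addr0 scaleN1r addNr.
by have := Alin i x a y 0; rewrite addr0 A0 addr0.
Qed.

(** The families equal to [y] on [s] and to [x] elsewhere reach a constant family one coordinate at
    a time; this lemma and the next isolate coordinate [i], then absorb it into the free part. *)
Lemma dfwith_seq_cons (E : Type) (s : seq 'I_m) i (x : 'I_m -> E) y :
  i \notin s -> (fun j => if j \in i :: s then y else x j) =
                dfwith (fun j => if j \in s then y else x j) i y.
Proof.
move=> si; apply/funext => j; rewrite inE.
have [->|ji] := eqVneq j i; first by rewrite dfwithin.
by rewrite dfwithout// eq_sym.
Qed.

Lemma dfwith_seq (E : Type) (s : seq 'I_m) i (x : 'I_m -> E) y z :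
  i \notin s -> dfwith (fun j => if j \in s then y else x j) i z =
                (fun j => if j \in s then y else dfwith x i z j).
Proof.
move=> si; apply/funext => j; have [<-|ij] := eqVneq i j.
  by rewrite !dfwithin (negbTE si).
by rewrite !dfwithout.
Qed.

Lemma enum_cst (E : Type) (x y : E) :
  (fun=> y) = (fun j : 'I_m => if j \in enum 'I_m then y else x).
Proof. by apply/funext => j; rewrite mem_enum. Qed.

Lemma multilinear_diagZ (E F : lmodType R) (A : ('I_m -> E) -> F) a x :
  multilinear A -> A (fun=> a *: x) = a ^+ m *: A (fun=> x).
Proof.
(* The free part [w] is arbitrary because the induction step alters it at the coordinate [i]. *)
move=> Alin; suff H (s : seq 'I_m) : uniq s -> forall w : 'I_m -> E,
    A (fun j => if j \in s then a *: x else w j) =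
    a ^+ size s *: A (fun j => if j \in s then x else w j).
  rewrite (enum_cst 0 (a *: x)) (enum_cst 0 x) H ?enum_uniq//.
  by rewrite size_enum_ord.
elim: s => [_ w|i s IH /= /andP[si us] w]; first by rewrite expr0 scale1r.
rewrite !dfwith_seq_cons// multilinear_dfwithZ// !dfwith_seq// IH//.
by rewrite scalerA exprS.
Qed.

Lemma multilinear_line_poly (E : lmodType R) (A : ('I_m -> E) -> R) x y :
  multilinear A -> exists f : {poly R}, forall t, A (fun=> t *: x + y) = f.[t].
Proof.
move=> Alin; suff H (s : seq 'I_m) : uniq s -> forall w : 'I_m -> E,
    exists f : {poly R}, forall t,
      A (fun j => if j \in s then t *: x + y else w j) = f.[t].
  have [f fP] := H _ (enum_uniq 'I_m) (fun=> 0).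
  by exists f => t; rewrite (enum_cst 0) fP.
elim: s => [_ w|i s IH /= /andP[si us] w].
  by exists (A w)%:P => t; rewrite hornerC.
have [f fP] := IH us (dfwith w i x); have [g gP] := IH us (dfwith w i y).
(* Linearity in coordinate [i] splits the value into [t] times the one with [x] there plus the one
   with [y] there. *)
exists ('X * f + g) => t.
by rewrite dfwith_seq_cons// Alin !dfwith_seq// fP gP !hornerE.
Qed.

Lemma poly_eq0_nat (f : {poly R}) : (forall k : nat, f.[k%:R] = 0) -> f = 0.
Proof.
move=> f0; apply/eqP/negP => /negP fn0.
(* [size f] distinct roots are one more than the degree allows. *)
pose s := [seq k%:R : R | k <- iota 0 (size f)].
have := @max_poly_roots _ f s fn0; rewrite size_map size_iota ltnn => noroots.
apply/notF/noroots.
  by apply/allP => _ /mapP[k _ ->]; rewrite /root f0.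
by rewrite map_inj_uniq ?iota_uniq//; exact: mulrIn (oner_neq0 R).
Qed.

(* Along the line through [lpos x] in direction [lneg x], [phi] is a          *)
(* polynomial in [t], and it vanishes for [t >= 0]; [x] is at [t = -1].       *)
Lemma hom_poly_eq0 (E : banachLatticeType R) (phi : E -> R) A :
  associated (m := m) A phi -> (forall x, 0 ⊑ x -> phi x = 0) ->
  forall x, phi x = 0.
Proof.
move=> [Alin _ AP] phi0 x.
have [f fP] := multilinear_line_poly (lneg x) (lpos x) Alin.
suff f0 : f = 0.
  by rewrite [x]lposBneg addrC -scaleN1r AP fP f0 horner0.
apply: poly_eq0_nat => k; rewrite -fP -AP; apply: phi0.
apply: lleD0 (lpos_ge0 _); apply: lleZ0 (lneg_ge0 _); exact: ler0n.
Qed.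

Lemma hom_poly_homogeneous (E F : normedModType R) (P : E -> F) :
  hom_poly m P -> forall a x, P (a *: x) = a ^+ m *: P x.
Proof.
by move=> [[A [Alin _ AP]] _] a x; rewrite !AP multilinear_diagZ.
Qed.

Lemma hom_poly_comp (E F G H : normedModType R) (P : E -> F)
    (u : {linear G -> E}) (v : {linear F -> H}) :
  continuous u -> continuous v -> hom_poly m P -> hom_poly m (v \o P \o u).
Proof.
move=> cu cv [[A AP] cP]; split.
  by exists (fun x => v (A (u \o x))); exact: associated_comp.
move=> x; apply: continuous_comp; first exact: cu.
by apply: continuous_comp; [exact: cP|exact: cv].
Qed.

Lemma pos_poly_comb (E F : banachLatticeType R) a (P Q : E -> F) : 0 <= a ->
  pos_poly m P -> pos_poly m Q -> pos_poly m (fun x => a *: P x + Q x).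
Proof.
move=> a0 [[_ cP] [A AP A0]] [[_ cQ] [B BQ B0]].
have ABPQ := associated_comb a AP BQ.
split; last first.
  exists (fun x => a *: A x + B x) => // x x0.
  exact: lleD0 (lleZ0 a0 (A0 _ x0)) (B0 _ x0).
split; first by exists (fun x => a *: A x + B x).
by move=> x; apply: cvgD; [apply: cvgZl_tmp; exact: cP|exact: cQ].
Qed.

Lemma pos_poly0 (E F : banachLatticeType R) : pos_poly m (fun _ : E => 0 : F).
Proof.
have a0 := associated0 E F; split; last first.
  by exists (fun=> 0) => // x _; exact: lle_refl.
by split; [exists (fun=> 0)|move=> x; exact: cvg_cst].
Qed.

Lemma pos_polyZ (E F : banachLatticeType R) a (P : E -> F) : 0 <= a ->
  pos_poly m P -> pos_poly m (fun x => a *: P x).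
Proof.
move=> a0 P0; have := pos_poly_comb a0 P0 (@pos_poly0 E F).
by under eq_fun do rewrite addr0.
Qed.

Lemma pos_poly_comp (E F G : banachLatticeType R) (P : E -> F)
    (u : {linear G -> E}) :
  continuous u -> pos_operator u -> pos_poly m P -> pos_poly m (P \o u).
Proof.
move=> cu u0 [hP [A AP A0]]; split.
  apply: (@hom_poly_comp _ _ _ _ P u idfun) => // x; exact: cvg_id.
exists (fun x => A (u \o x)).
  exact: (@associated_comp _ _ _ _ A P u idfun).
by move=> x x0; apply: A0 => i; exact: u0.
Qed.

(** * Order, modulus and unit ball for scalar polynomials *)

Section scalar.
Variable E : banachLatticeType R.
Implicit Types phi psi : E -> R.

Lemma pos_poly_ge0 phi x : pos_poly m phi -> 0 ⊑ x -> 0 <= phi x.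
Proof. by move=> [_ [A [_ _ ->] A0]] x0; exact: A0. Qed.

(** Both differences are nonnegative on the cone, so they vanish there, and [hom_poly_eq0]
    applies. *)
Lemma poly_le_anti phi psi : poly_le m phi psi -> poly_le m psi phi ->
  phi = psi.
Proof.
move=> le1 le2; have [_ [A AP _]] := le1; apply/funext => x; apply/eqP.
rewrite eq_sym -subr_eq0; apply/eqP; apply: (hom_poly_eq0 AP) => y y0.
have := pos_poly_ge0 le1 y0; have := pos_poly_ge0 le2 y0.
rewrite !fctE !subr_ge0 => h1 h2.
by apply/eqP; rewrite subr_eq0 eq_le h1 h2.
Qed.

Lemma pos_poly_reg phi : pos_poly m phi -> reg_poly m phi.
Proof.
move=> phi0; exists phi, (fun=> 0); split => //; first exact: pos_poly0.
by apply/funext => x; rewrite !fctE subr0.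
Qed.

(** [phi] is a least upper bound of [phi] and [- phi], since [phi + phi] is positive; antisymmetry
    makes it the one that [xget] picks. *)
Lemma poly_modulus_pos phi : pos_poly m phi -> poly_modulus m phi = phi.
Proof.
move=> phi0; have modphi : is_poly_modulus m phi phi.
  split => //; first exact: pos_poly_reg.
    rewrite /poly_le subrr; exact: pos_poly0.
  rewrite /poly_le opprK; have := pos_poly_comb ler01 phi0 phi0.
  by under eq_fun do rewrite scale1r.
rewrite /poly_modulus; case: xgetP => [psi _ [rpsi le1 le2 min]|/(_ phi)//].
apply: poly_le_anti => //; case: modphi => *; exact: min.
Qed.

(** The regular norm of a positive [phi] is its sup norm, which homogeneity turns into a pointwise
    estimate that is easy to rescale. *)
Lemma pos_reg_ball_pos phi : pos_reg_ball m phi <->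
  pos_poly m phi /\ forall x, `|phi x| <= `|x| ^+ m.
Proof.
split=> [[_ phi0]|[phi0 phi1]].
  rewrite /reg_norm poly_modulus_pos// => phi1; split => // x.
  have [hphi _] := phi0; have hom := hom_poly_homogeneous hphi.
  apply: le_trans (unif_norm_ub hom hphi.2 x) _.
  by rewrite ler_piMl// exprn_ge0.
split => //; first exact: pos_poly_reg.
rewrite /reg_norm poly_modulus_pos//; apply: unif_norm_le => x x1.
by apply: le_trans (phi1 x) _; rewrite exprn_ile1.
Qed.

End scalar.
End polynomials.

(** * Weak norms under positive operators *)

Section weak_norms.
Variables (R : realType) (m : nat) (q : \bar R).
Hypothesis q_ge1 : (1 <= q)%E.

Lemma poly_weak_norm_ge0 (E : banachLatticeType R) n (x : 'I_n -> E) :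
  0 <= poly_weak_norm m q x.
Proof. by apply: sup_ge0 => _ [phi _ <-]; exact: lp_norm_ge0. Qed.

Lemma abs_weak_norm_ge0 (E : banachLatticeType R) n (x : 'I_n -> E) :
  0 <= abs_weak_norm q x.
Proof. by apply: sup_ge0 => _ [xi _ <-]; exact: lp_norm_ge0. Qed.

Lemma poly_weak_norm_ub (E : banachLatticeType R) n (x : 'I_n -> E) phi :
  pos_reg_ball m phi -> lp_norm q (phi \o x) <= poly_weak_norm m q x.
Proof.
move=> phiB; apply: ub_le_sup; last by exists phi.
exists (lp_norm q (fun i => `|x i| ^+ m)).
move=> _ [psi /pos_reg_ball_pos[_ psiB] <-].
by apply: lp_norm_le => // i; rewrite [leRHS]ger0_norm ?exprn_ge0.
Qed.

Lemma abs_weak_norm_ub (E : banachLatticeType R) n (x : 'I_n -> E)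
    (xi : dual E) : `|xi| <= 1 -> 0 ⊑ xi ->
  lp_norm q (fun i => xi (modulus (x i))) <= abs_weak_norm q x.
Proof.
move=> xi1 xi0; apply: ub_le_sup; last by exists xi.
exists (lp_norm q (fun i => `|x i|)) => _ [eta [eta1 _] <-].
apply: lp_norm_le => // i; rewrite normr_id -[leRHS]lnorm_modulus.
by apply: le_trans (dual_norm_ub _ _) _; rewrite ler_piMl.
Qed.

Variables (E F : banachLatticeType R) (u : {linear E -> F}).
Hypothesis u_cont : continuous u.
Hypothesis u_pos : pos_operator u.

Lemma poly_weak_norm_comp n (x : 'I_n -> E) : (0 < m)%N ->
  poly_weak_norm m q (u \o x) <= unif_norm u ^+ m * poly_weak_norm m q x.
Proof.
move=> m0; apply: ge_sup.
  exists (lp_norm q (fun _ : 'I_n => 0)), (fun=> 0) => //.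
  apply/pos_reg_ball_pos; split => [|y]; first exact: pos_poly0.
  by rewrite normr0 exprn_ge0.
move=> _ [phi /pos_reg_ball_pos[phi0 phiB] <-].
(* If [u] has norm 0, no normalisation is possible; both sides are then 0, as [m] is positive. *)
have /predU1P[nu|nu] : (0 == unif_norm u) || (0 < unif_norm u).
  by rewrite -le_eqVlt opnorm_ge0.
  rewrite lp_norm0//; first by rewrite -nu expr0n gtn_eqF// mul0r.
  move=> i; have := opnorm_ub u_cont (x i).
  rewrite -nu mul0r normr_le0 => /eqP xi0.
  apply/eqP; rewrite -normr_le0 (le_trans (phiB _))//= xi0.
  by rewrite normr0 expr0n gtn_eqF.
set K := unif_norm u ^+ m; have K0 : 0 < K by rewrite exprn_gt0.
pose psi z : R := K^-1 *: phi (u z).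
have psiB : pos_reg_ball m psi.
  apply/pos_reg_ball_pos; split => [|z].
    apply: (@pos_polyZ _ _ E R K^-1 (phi \o u)); first by rewrite invr_ge0 ltW.
    exact: pos_poly_comp.
  rewrite normrM normfV (gtr0_norm K0) ler_pdivrMl// (le_trans (phiB _))//.
  by rewrite -exprMn lerXn2r ?nnegrE ?mulr_ge0 ?opnorm_ub// ltW.
have -> : (fun i => phi ((u \o x) i)) = (fun i => K * psi (x i)).
  by apply/funext => i; rewrite /psi/= /GRing.scale/= mulVKf ?gt_eqF.
by rewrite lp_normZ ?(ltW K0)// ler_wpM2l ?(ltW K0)//; exact: poly_weak_norm_ub.
Qed.

Lemma adjoint_pos : pos_operator (adjoint u_cont).
Proof.
move=> y y0; change (dual_le 0 (adjoint u_cont y)) => x x0.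
exact: y0 (u_pos x0).
Qed.

Lemma abs_weak_norm_comp n (x : 'I_n -> E) : (forall i, 0 ⊑ x i) ->
  abs_weak_norm q (u \o x) <= unif_norm u * abs_weak_norm q x.
Proof.
move=> x0; apply: ge_sup.
  exists (lp_norm q (fun _ : 'I_n => 0)), 0 => //.
  by rewrite /= normr0; split => //; exact: lle_refl.
move=> _ [xi [xi1 xi0] <-].
(* Positivity of [u] and of the [x i] removes the moduli, leaving the functional [xi o u] to be
   normalised. *)
have -> : (fun i => xi (modulus ((u \o x) i))) = (fun i => xi (u (x i))).
  by apply/funext => i; rewrite modulus_id//; exact: u_pos.
have /predU1P[nu|nu] : (0 == unif_norm u) || (0 < unif_norm u).
  by rewrite -le_eqVlt opnorm_ge0.
  rewrite lp_norm0//; first by rewrite -nu mul0r.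
  move=> i; have := opnorm_ub u_cont (x i).
  rewrite -nu mul0r normr_le0 => /eqP ->.
  by rewrite linear0.
set K := unif_norm u in nu *.
pose eta := K^-1 *: adjoint u_cont xi.
have eta1 : `|eta| <= 1.
  rewrite normrZ normfV (gtr0_norm nu) ler_pdivrMl// mulr1.
  by rewrite (le_trans (adjoint_norm _ _))// ler_piMr// ltW.
have eta0 : 0 ⊑ eta by apply: lleZ0 (adjoint_pos xi0); rewrite invr_ge0 ltW.
have -> : (fun i => xi (u (x i))) = (fun i => K * eta (modulus (x i))).
  by apply/funext => i; rewrite modulus_id// dualZE /= mulVKf ?gt_eqF.
by rewrite lp_normZ ?(ltW nu)// ler_wpM2l ?(ltW nu)//; exact: abs_weak_norm_ub.
Qed.

End weak_norms.

(** * Domination of the composite and the norm estimate *)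

Lemma dominated_by_comp (R : realType) (m : nat) (p q r : \bar R)
    (E F G H : banachLatticeType R) (P : E -> F)
    (u : {linear G -> E}) (v : {linear F -> H}) (C : R) :
  (0 < m)%N -> (1 <= q)%E -> (1 <= r)%E ->
  continuous u -> pos_operator u -> continuous v -> pos_operator v ->
  0 <= C -> Defs.dominated_by m p q r P C ->
  Defs.dominated_by m p q r (v \o P \o u) (unif_norm v * C * unif_norm u ^+ m).
Proof.
move=> m0 q1 r1 cu u0 cv v0 C0 PC n x y x0 y0.
have ux0 i : 0 ⊑ (u \o x) i by exact: u0.
have vy0 i : 0 ⊑ (adjoint cv \o y) i by exact: adjoint_pos.
(* The left sides agree by computation, since [adjoint cv (y i)] at [P (u (x i))] is [y i] at
   [v (P (u (x i)))]. *)
apply: le_trans (PC n _ _ ux0 vy0) _.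
have nv := opnorm_ge0 cv.
have h1 := poly_weak_norm_comp q1 cu u0 x m0.
have h2 : abs_weak_norm r (adjoint cv \o y) <= unif_norm v * abs_weak_norm r y.
  apply: le_trans (abs_weak_norm_comp r1 _ _ y0) _.
  - exact: adjoint_continuous.
  - exact: adjoint_pos.
  - by rewrite ler_wpM2r ?abs_weak_norm_ge0 ?unif_norm_adjoint.
have -> : unif_norm v * C * unif_norm u ^+ m * poly_weak_norm m q x *
    abs_weak_norm r y = C * (unif_norm u ^+ m * poly_weak_norm m q x) *
    (unif_norm v * abs_weak_norm r y) by ring.
apply: ler_pM => //; last by rewrite ler_wpM2l.
  by rewrite mulr_ge0 ?poly_weak_norm_ge0.
exact: abs_weak_norm_ge0.
Qed.

Lemma dominated_byW (R : realType) (m : nat) (p q r : \bar R)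
    (E F : banachLatticeType R) (P : E -> F) (C D : R) :
  C <= D -> Defs.dominated_by m p q r P C -> Defs.dominated_by m p q r P D.
Proof.
move=> CD PC n x y x0 y0; apply: le_trans (PC n x y x0 y0) _.
by rewrite !ler_wpM2r ?abs_weak_norm_ge0 ?poly_weak_norm_ge0.
Qed.

Theorem proposition2p8 (R : realType) (m : nat) (p q r : \bar R)
    (E F G H : banachLatticeType R) (P : E -> F)
    (u : {linear G -> E}) (v : {linear F -> H})
    (m_gt0 : (0 < m)%N)
    (p_ge1 : (1 <= p)%E) (q_ge1 : (1 <= q)%E) (r_ge1 : (1 <= r)%E)
    (pqr : (p^-1 = q^-1 + r^-1)%E)
    (u_cont : continuous u) (u_pos : pos_operator u)
    (v_cont : continuous v) (v_pos : pos_operator v)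
    (P_dom : pos_weak_dominated m p q r P) :
  pos_weak_dominated m p q r (v \o P \o u) /\
  dominated_norm m p q r (v \o P \o u)
    <= unif_norm v * dominated_norm m p q r P * unif_norm u ^+ m.
Proof.
have [hP [C0 C0_gt0 PC0]] := P_dom.
have nv := opnorm_ge0 v_cont; have nu := opnorm_ge0 u_cont.
pose K := unif_norm v * unif_norm u ^+ m.
have K0 : 0 <= K by rewrite mulr_ge0 ?exprn_ge0.
(* Admissible constants must be positive while [K] may be 0; the slack [e] repairs this and is sent
   to 0 below. *)
have dom C e : 0 < C -> 0 < e -> Defs.dominated_by m p q r P C ->
    0 < K * C + e /\ Defs.dominated_by m p q r (v \o P \o u) (K * C + e).
  move=> /ltW C_ge0 e0 PC; split; first by rewrite ltr_wpDl// mulr_ge0.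
  apply: (@dominated_byW _ _ _ _ _ _ _ _ (unif_norm v * C * unif_norm u ^+ m)).
    by rewrite mulrAC lerDl ltW.
  exact: dominated_by_comp.
split.
  split; first exact: hom_poly_comp.
  by have [] := dom _ _ C0_gt0 ltr01 PC0; exists (K * C0 + 1).
have le C : 0 < C -> Defs.dominated_by m p q r P C ->
    dominated_norm m p q r (v \o P \o u) <= K * C.
  move=> C_gt0 PC; apply/ler_addgt0Pr => e e0; apply: ge_inf; last exact: dom.
  by exists 0 => D [/ltW].
(* If [K = 0], a single constant [C0] already gives the bound 0; otherwise dividing by [K] gives a
   lower bound of all constants for [P]. *)
rewrite mulrAC -/K; move: K0; rewrite le_eqVlt => /predU1P[K0|K0].
  by have := le _ C0_gt0 PC0; rewrite -K0 !mul0r.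
rewrite -ler_pdivrMl//; apply: lb_le_inf; first by exists C0.
by move=> C [C_gt0 PC]; rewrite ler_pdivrMl// le.
Qed.
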